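(* Let $\mathcal O$ be the suboperad of $\mathrm{CNCB}$ generated by $s:=T_{ubb}$ and $w:=T_{bub}$. Then $\mathcal O$ admits the presentation with generators $s,w$ of arity $2$ and relations $$w\circ_1 w=w\circ_2 w,\qquad s\circ_1 s=s\circ_2 w.$$ That is, $\mathcal O$ is isomorphic, via the morphism sending the generators to $s$ and $w$, to the quotient of the free operad on two binary generators by the operadic congruence generated by these relations.
   Context: For $n\ge2$, a bicoloured noncrossing configuration (BNC) of size $n$ is a regular polygon with vertices $1,\dots,n+1$ clockwise, together with disjoint sets of blue and red arcs among the arcs $(i,j)$, $1\le i<j\le n+1$. The arcs $(i,i+1)$ are the edges ($i$th edge), $(1,n+1)$ is the base, and the others are diagonals. Coloured arcs are pairwise noncrossing ($(i,j),(k,l)$ cross iff $i<k<j<l$ or $k<i<l<j$), and red arcs are diagonals. There is one BNC of size $1$, a blue segment, which is the unit. The operad $\mathrm{CNCB}$ has the BNCs as elements (arity = size). Its composition $\mathfrak C\circ_i\mathfrak D$ ($\mathfrak C$ of size $n$, $\mathfrak D$ of size $m$) glues the base of $\mathfrak D$ on the $i$th edge of $\mathfrak C$. Arcs $(a,b)$ of $\mathfrak C$ become $(\sigma(a),\sigma(b))$ with $\sigma(v)=v$ for $v\le i$ and $v+m-1$ otherwise, and arcs $(a,b)$ of $\mathfrak D$ become $(a+i-1,b+i-1)$, keeping colours. The exception is the arc $(i,i+m)$, which is red if the $i$th edge of $\mathfrak C$ and the base of $\mathfrak D$ are both uncoloured, blue if both are blue, and uncoloured otherwise. For $x,y,z\in\{b,u\}$,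 $T_{xyz}$ denotes the BNC of size $2$ (a triangle with vertices $1,2,3$) whose first edge $(1,2)$ has colour $x$, whose base $(1,3)$ has colour $y$, and whose second edge $(2,3)$ has colour $z$, where $b$ = blue and $u$ = uncoloured. The suboperad generated by a set is the smallest suboperad containing it. *)

(* Defs.v *)
From mathcomp Require Import all_boot.
Set Implicit Arguments. Unset Strict Implicit. Unset Printing Implicit Defensive.

Inductive color := Blue | Red | Uncol.

(* A configuration of size n: vertices 1..n+1, colour of the arc (a,b), a<b,
   given by [ccol a b]; all pairs that are not arcs get [Uncol]. *)
Record config := Config { csize : nat ; ccol : nat -> nat -> color }.

Definition cross (a b c d : nat) : bool :=
  ((a < c) && (c < b) && (b < d)) || ((c < a) && (a < d) && (d < b)).

Definition is_bnc (x : config) : Prop :=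
  let n := csize x in
  [/\ 1 <= n,
      (forall a b, ccol x a b <> Uncol -> (1 <= a) && (a < b) && (b <= n.+1)),
      (* red arcs are diagonals: neither edges nor the base *)
      (forall a b, ccol x a b = Red -> b <> a.+1 /\ ~ (a = 1 /\ b = n.+1)),
      (forall a b c d, ccol x a b <> Uncol -> ccol x c d <> Uncol ->
          ~~ cross a b c d)
    & (* the unique BNC of size 1 is the blue segment *)
      (n = 1 -> ccol x 1 2 = Blue)].

(* colour of the arc (i, i+m) in C o_i D: from the i-th edge of C and
   the base of D *)
Definition special (e bs : color) : color :=
  match e, bs with
  | Uncol, Uncol => Red
  | Blue, Blue => Blue
  | _, _ => Uncol
  end.

(* partial composition C o_i D of CNCB (glue base of D on i-th edge of C) *)
Definition comp (C : config) (i : nat) (D : config) : config :=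
  let n := csize C in
  let m := csize D in
  let back v := if v <= i then v else v - m + 1 in
  Config (n + m - 1) (fun a b =>
    if (1 <= a) && (a < b) && (b <= n + m) then
      if (a == i) && (b == i + m) then special (ccol C i i.+1) (ccol D 1 m.+1)
      else if (i <= a) && (b <= i + m) then ccol D (a - i + 1) (b - i + 1)
      else if ((a <= i) || (i + m <= a)) && ((b <= i) || (i + m <= b))
           then ccol C (back a) (back b)
      else Uncol
    else Uncol).

Definition unit_bnc : config :=
  Config 1 (fun a b => if (a == 1) && (b == 2) then Blue else Uncol).

(* T_xyz : triangle, first edge (1,2) colour x, base (1,3) colour y,
   second edge (2,3) colour z *)
Definition triangle (x y z : color) : config :=
  Config 2 (fun a b =>
    if (a == 1) && (b == 2) then x
    else if (a == 1) && (b == 3) then y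
    else if (a == 2) && (b == 3) then z
    else Uncol).

Definition s_gen : config := triangle Uncol Blue Blue.
Definition w_gen : config := triangle Blue Uncol Blue.

Definition in_O (x : config) : Prop :=
  forall P : config -> Prop,
    (forall y, P y -> is_bnc y) ->
    P unit_bnc ->
    (forall y z i, P y -> P z -> 1 <= i <= csize y -> P (comp y i z)) ->
    P s_gen -> P w_gen -> P x.

Inductive gen := GS | GW.

Inductive tree := Leaf | Node of gen & tree & tree.

Fixpoint arity (t : tree) : nat :=
  match t with Leaf => 1 | Node _ l r => arity l + arity r end.

Fixpoint graft (t : tree) (i : nat) (u : tree) : tree :=
  match t with
  | Leaf => if i == 1 then u else Leaf
  | Node g l r =>
      if i <= arity l then Node g (graft l i u) r
      else Node g l (graft r (i - arity l) u)
  end.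

Definition gtree (g : gen) : tree := Node g Leaf Leaf.

Definition rel_w_lhs := graft (gtree GW) 1 (gtree GW).
Definition rel_w_rhs := graft (gtree GW) 2 (gtree GW).
Definition rel_s_lhs := graft (gtree GS) 1 (gtree GS).
Definition rel_s_rhs := graft (gtree GS) 2 (gtree GW).

Inductive cong : tree -> tree -> Prop :=
  | cong_relw : cong rel_w_lhs rel_w_rhs
  | cong_rels : cong rel_s_lhs rel_s_rhs
  | cong_refl t : cong t t
  | cong_sym t t' : cong t t' -> cong t' t
  | cong_trans t t' t'' : cong t t' -> cong t' t'' -> cong t t''
  | cong_compl t t' u i : cong t t' -> 1 <= i <= arity t ->
      cong (graft t i u) (graft t' i u)
  | cong_compr t u u' i : cong u u' -> 1 <= i <= arity t ->
      cong (graft t i u) (graft t i u').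

Definition gen_val (g : gen) : config :=
  match g with GS => s_gen | GW => w_gen end.

Fixpoint ev (t : tree) : config :=
  match t with
  | Leaf => unit_bnc
  | Node g l r => comp (comp (gen_val g) 2 (ev r)) 1 (ev l)
  end.

(* Main.v *)
From mathcomp Require Import all_boot zify.
From Stdlib Require Import FunctionalExtensionality.
Require Import Defs.
Set Implicit Arguments. Unset Strict Implicit. Unset Printing Implicit Defensive.

(** Evaluation of trees sends grafting to composition, because composition of
  BNCs is unital and satisfies the sequential and parallel associativity laws;
  since the two relations hold in CNCB, congruent trees have the same value.
  Conversely, orienting the relations as
    w(w(a,b),c) -> w(a,w(b,c))   and   s(s(a,b),c) -> s(a,w(b,c))
  brings every tree to a normal form in which no w has a w as left child and no
  s has an s as left child. A normal tree can be read off its BNC: the base is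
  uncoloured exactly when the root is w, and the arity of the left subtree is
  v - 1 for the largest v, other than the end of the base, such that (1,v) is
  coloured (v = 2 if there is none). Cutting along (1,v) recovers the two
  subtrees, as a normal left subtree has its base colour determined. *)

(** * Operad laws of CNCB *)

Lemma config_ext (x y : config) :
  csize x = csize y -> (forall a b, ccol x a b = ccol y a b) -> x = y.
Proof.
case: x y => [n f] [m g] /= -> fg; congr Config.
by apply: functional_extensionality => a; apply: functional_extensionality.
Qed.

(* The position of [(a, b)] relative to the glued polygon [D], whose vertices
   become [i], ..., [i + csize D]; [a'] and [b'] are the preimages of [a] and
   [b]. Given [a' <= i < b'], the condition [a'.+1 < b'] means that [(a', b')]
   is not the [i]th edge; dually [b' < a' + csize D] excludes the base. *)
Variant comp_spec (C : config) (i : nat) (D : config) (a b : nat) : color -> Prop :=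
  | CompNotArc of ~~ [&& 1 <= a, a < b & b <= csize C + csize D] :
      comp_spec C i D a b Uncol
  | CompGlue of a = i & b = i + csize D :
      comp_spec C i D a b (special (ccol C i i.+1) (ccol D 1 (csize D).+1))
  | CompInner a' b' of a.+1 = a' + i & b.+1 = b' + i &
      1 <= a' & a' < b' & b' <= (csize D).+1 & b' < a' + csize D :
      comp_spec C i D a b (ccol D a' b')
  | CompBefore of 1 <= a & a < b & b <= i : comp_spec C i D a b (ccol C a b)
  | CompAfter a' b' of a.+1 = a' + csize D & b.+1 = b' + csize D &
      i < a' & a' < b' & b' <= (csize C).+1 :
      comp_spec C i D a b (ccol C a' b')
  | CompOver b' of 1 <= a & a <= i & i < b' & b' <= (csize C).+1 & a.+1 < b' &
      b.+1 = b' + csize D :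
      comp_spec C i D a b (ccol C a b')
  | CompCrossL of 1 <= a & a < i & i < b & b < i + csize D :
      comp_spec C i D a b Uncol
  | CompCrossR of i < a & a < i + csize D & i + csize D < b
      & b <= csize C + csize D :
      comp_spec C i D a b Uncol.

Section CompE.
Variables (C D : config) (i : nat).
Hypotheses (hi : 1 <= i <= csize C) (hm : 1 <= csize D).

Lemma comp_notarcE a b :
  ~~ [&& 1 <= a, a < b & b <= csize C + csize D] ->
  ccol (comp C i D) a b = Uncol.
Proof. by move=> ? /=; rewrite ifF //; lia. Qed.

Lemma comp_glueE a b : a = i -> b = i + csize D ->
  ccol (comp C i D) a b = special (ccol C i i.+1) (ccol D 1 (csize D).+1).
Proof. by move=> -> -> /=; rewrite !eqxx /= ifT //; lia. Qed.

Lemma comp_innerE a' b' a b :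
  [&& 1 <= a', a' < b' & b' <= (csize D).+1] -> b' < a' + csize D ->
  a.+1 = a' + i -> b.+1 = b' + i -> ccol (comp C i D) a b = ccol D a' b'.
Proof.
move=> * /=; rewrite ifT; last by lia.
rewrite ifF; last by lia.
by rewrite ifT; [congr ccol|]; lia.
Qed.

Lemma comp_beforeE a b : 1 <= a -> a < b -> b <= i ->
  ccol (comp C i D) a b = ccol C a b.
Proof.
move=> * /=; rewrite ifT; last by lia.
do 2!(rewrite ifF; last by lia); rewrite ifT; last by lia.
by congr ccol; rewrite ifT //; lia.
Qed.

Lemma comp_afterE a' b' a b :
  [&& i < a', a' < b' & b' <= (csize C).+1] ->
  a.+1 = a' + csize D -> b.+1 = b' + csize D ->
  ccol (comp C i D) a b = ccol C a' b'.
Proof.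
move=> * /=; rewrite ifT; last by lia.
do 2!(rewrite ifF; last by lia); rewrite ifT; last by lia.
by congr ccol; rewrite ifF; lia.
Qed.

Lemma comp_overE b' a b :
  [&& 1 <= a, a <= i, i < b', b' <= (csize C).+1 & a.+1 < b'] ->
  b.+1 = b' + csize D -> ccol (comp C i D) a b = ccol C a b'.
Proof.
move=> * /=; rewrite ifT; last by lia.
do 2!(rewrite ifF; last by lia); rewrite ifT; last by lia.
by congr ccol; [rewrite ifT|rewrite ifF]; lia.
Qed.

Lemma comp_crossLE a b : a < i -> i < b -> b < i + csize D ->
  ccol (comp C i D) a b = Uncol.
Proof. by move=> * /=; case: ifP => // _; rewrite !ifF //; lia. Qed.

Lemma comp_crossRE a b : i < a -> a < i + csize D -> i + csize D < b ->
  ccol (comp C i D) a b = Uncol.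
Proof. by move=> * /=; case: ifP => // _; rewrite !ifF //; lia. Qed.

Lemma compP a b : comp_spec C i D a b (ccol (comp C i D) a b).
Proof.
have [arc|] := boolP [&& 1 <= a, a < b & b <= csize C + csize D]; last first.
  by move=> na; rewrite comp_notarcE //; constructor.
have [bi|ib] := leqP b i.
  by rewrite comp_beforeE; [apply: CompBefore|..]; lia.
have [ia|ai] := leqP (i + csize D) a.
  by rewrite (@comp_afterE (a.+1 - csize D) (b.+1 - csize D));
    [apply: CompAfter|..]; lia.
have [ia|{}ai] := leqP i a; have [bim|imb] := leqP b (i + csize D).
- have [g|ng] := eqVneq (b - a) (csize D).
    by rewrite comp_glueE; [apply: CompGlue|..]; lia.
  by rewrite (@comp_innerE (a.+1 - i) (b.+1 - i)); [apply: CompInner|..]; lia.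
- have [{}ia|{}ai] := ltnP i a.
    by rewrite comp_crossRE; [apply: CompCrossR|..]; lia.
  by rewrite (@comp_overE (b.+1 - csize D)); [apply: CompOver|..]; lia.
- have [imb|{}bim] := leqP (i + csize D) b.
    by rewrite (@comp_overE (b.+1 - csize D)); [apply: CompOver|..]; lia.
  by rewrite comp_crossLE; [apply: CompCrossL|..]; lia.
- by rewrite (@comp_overE (b.+1 - csize D)); [apply: CompOver|..]; lia.
Qed.

End CompE.
Arguments comp_innerE {C D i} hi hm a' b' {a b}.
Arguments comp_afterE {C D i} hi hm a' b' {a b}.
Arguments comp_overE {C D i} hi hm b' {a b}.

(** * Closure under composition, unit laws and associativity *)

Lemma special_blue_l c : c <> Red -> special Blue c = c.
Proof. by case: c. Qed.

Lemma special_blue_r c : c <> Red -> special c Blue = c.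
Proof. by case: c. Qed.

Lemma special_red c d : special c d = Red -> c = Uncol /\ d = Uncol.
Proof. by case: c; case: d. Qed.

Section BncTheory.
Variable C : config.
Hypothesis bC : is_bnc C.

Lemma bnc_size_gt0 : 1 <= csize C. Proof. by case: bC. Qed.

Lemma bnc_notarc a b :
  ~~ [&& 1 <= a, a < b & b <= (csize C).+1] -> ccol C a b = Uncol.
Proof.
case: bC => _ H _ _ _; case E: (ccol C a b) => //;
by move: (H a b); rewrite E => /(_ ltac:(by [])); lia.
Qed.

Lemma bnc_edge_neq_red a : ccol C a a.+1 <> Red.
Proof. by case: bC => _ _ H _ _ /H[]. Qed.

Lemma bnc_base_neq_red : ccol C 1 (csize C).+1 <> Red.
Proof. by case: bC => _ _ H _ _ /H[]; lia. Qed.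

Lemma bnc_size1 : csize C = 1 -> ccol C 1 2 = Blue.
Proof. by case: bC. Qed.

End BncTheory.

Lemma csize_comp C i D : csize (comp C i D) = csize C + csize D - 1.
Proof. by []. Qed.

(** A red glued arc comes from two uncoloured arcs; as the segment is blue, neither factor has size
    1, so the glued arc is a diagonal of the composite. *)
Lemma bnc_comp C i D : is_bnc C -> is_bnc D -> 1 <= i <= csize C ->
  is_bnc (comp C i D).
Proof.
move=> bC bD hi; have hm := bnc_size_gt0 bD; have hn := bnc_size_gt0 bC.
split; rewrite ?csize_comp.
- by lia.
- by move=> a b; case: (compP hi hm a b) => //; lia.
- move=> a b; case: (compP hi hm a b) => //.
  + move=> Ea Eb /special_red [EC ED].
    have nm1 : csize D <> 1.
      by move=> E; move: (bnc_size1 bD E); move: ED; rewrite E => ->.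
    have nn1 : csize C <> 1.
      move=> E; move: (bnc_size1 bC E); move: EC.
      by (have -> : i = 1 by lia) => ->.
    by lia.
  + by move=> a' b' ? ? ? ? ? ?; case: bD => _ _ H _ _ /H; lia.
  + by move=> ? ? ?; case: bC => _ _ H _ _ /H; lia.
  + by move=> a' b' ? ? ? ? ?; case: bC => _ _ H _ _ /H; lia.
  + by move=> b' ? ? ? ? ? ?; case: bC => _ _ H _ _ /H; lia.
- move=> a b c d.
  have NC : forall x y z t, ccol C x y <> Uncol -> ccol C z t <> Uncol -> ~~ cross x y z t by case: bC.
  have ND : forall x y z t, ccol D x y <> Uncol -> ccol D z t <> Uncol -> ~~ cross x y z t by case: bD.
  (* Two arcs from the same factor inherit noncrossing. In the mixed cases, and when the glued arc
     is involved, positions alone suffice: any pair crossing the glued arc is uncoloured. *)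
  case: (compP hi hm a b) => //; case: (compP hi hm c d) => // *;
  match goal with
  | H1 : ccol C _ _ <> Uncol, H2 : ccol C _ _ <> Uncol |- _ =>
      move: (NC _ _ _ _ H1 H2)
  | H1 : ccol D _ _ <> Uncol, H2 : ccol D _ _ <> Uncol |- _ =>
      move: (ND _ _ _ _ H1 H2)
  | |- _ => idtac end; rewrite /cross; clear bC bD NC ND; by lia.
- move=> E; have [En Em] : csize C = 1 /\ csize D = 1 by lia.
  have -> : i = 1 by lia.
  by rewrite comp_glueE ?Em ?En // !bnc_size1.
Qed.

Lemma comp_unit_l D : is_bnc D -> comp unit_bnc 1 D = D.
Proof.
move=> bD; have hm := bnc_size_gt0 bD.
apply: config_ext => [|a b]; first by rewrite /=; lia.
have s1 : csize unit_bnc = 1 by [].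
case: compP => //.
- by move=> ?; rewrite bnc_notarc //; lia.
- by move=> -> ->; rewrite special_blue_l //; apply: bnc_base_neq_red.
- by move=> *; congr ccol; lia.
all: by move=> *; exfalso; lia.
Qed.

Lemma comp_unit_r C i : is_bnc C -> 1 <= i <= csize C -> comp C i unit_bnc = C.
Proof.
move=> bC hi.
apply: config_ext => [|a b]; first by rewrite /=; lia.
have s1 : csize unit_bnc = 1 by [].
case: compP => //; rewrite ?s1.
- by move=> ?; rewrite bnc_notarc //; lia.
- move=> -> ->; rewrite special_blue_r; last exact: bnc_edge_neq_red.
  by rewrite addn1.
- by move=> *; exfalso; lia.
- by move=> *; congr ccol; lia.
- by move=> *; congr ccol; lia.
all: by move=> *; exfalso; lia.
Qed.

(** The position of an arc relative to the three polygons determines its colour on both sides. Only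
    glued arcs need care, since [special] could be applied to them twice. *)
Lemma comp_seqA C i D j E k : is_bnc C -> is_bnc D -> is_bnc E ->
  1 <= i <= csize C -> 1 <= j <= csize D -> k.+1 = i + j ->
  comp (comp C i D) k E = comp C i (comp D j E).
Proof.
move=> bC bD bE hi hj hk; have hm := bnc_size_gt0 bD; have he := bnc_size_gt0 bE.
have sCD := csize_comp C i D; have sDE := csize_comp D j E.
apply: config_ext => [|a b]; first by rewrite !csize_comp; lia.
case: compP; [lia|lia|..].
- by move=> ?; rewrite comp_notarcE //; lia.
(* If [D] is the segment, its edge is also its base and the two glued arcs coincide; the blue
   segment is then neutral for [special] on either side. Otherwise the [j]th edge of [D] is not its
   base and the gluings do not interact. *)
- move=> Ea Eb; have [D1|Dn1] := eqVneq (csize D) 1.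
    rewrite !comp_glueE ?(comp_glueE (C := D)); try lia.
    have -> : j = 1 by lia.
    rewrite D1 bnc_size1 // special_blue_r ?special_blue_l //.
      exact: bnc_base_neq_red.
    exact: bnc_edge_neq_red.
  rewrite (comp_innerE _ _ j j.+1); try lia.
  rewrite (comp_innerE _ _ j (j + csize E)); try lia.
  by rewrite comp_glueE.
- move=> a' b' *.
  rewrite (comp_innerE _ _ (a' + j - 1) (b' + j - 1)); try lia.
  by rewrite (comp_innerE _ _ a' b') //; lia.
- move=> ? ? ?; case: (compP (D := D)); try lia.
  + move=> a' b' *.
    rewrite (comp_innerE _ _ a' b'); try lia.
    by rewrite comp_beforeE //; lia.
  + by move=> *; rewrite comp_beforeE //; lia.
  + by move=> *; rewrite comp_crossLE //; lia.
- move=> a' b' ? ? ? ? ?; case: (@compP C D i _ _ a' b'); try lia.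
  + move=> a'' b'' *.
    rewrite (comp_innerE _ _ (a'' + csize E - 1) (b'' + csize E - 1)); try lia.
    by rewrite (comp_afterE _ _ a'' b'') //; lia.
  + by move=> a'' b'' *; rewrite (comp_afterE _ _ a'' b'') //; lia.
  + by move=> *; rewrite comp_crossRE //; lia.
- move=> b' ? ? ? ? ? ?; case: (@compP C D i _ _ a b'); try lia.
  + move=> *; rewrite comp_glueE; try lia.
    by rewrite (comp_overE _ _ (csize D).+1) //; lia.
  + move=> a'' b'' *.
    rewrite (comp_innerE _ _ a'' (b'' + csize E - 1)); try lia.
    by rewrite (comp_overE _ _ b'') //; lia.
  + by move=> b'' *; rewrite (comp_overE _ _ b'') //; lia.
  + by move=> *; rewrite comp_crossLE //; lia.
  + by move=> *; rewrite comp_crossRE //; lia.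
- move=> *; have [ai|ia] := ltnP a i; first by rewrite comp_crossLE //; lia.
  rewrite (comp_innerE _ _ (a.+1 - i) (b.+1 - i)); try lia.
  by rewrite comp_crossLE //; lia.
- move=> *; have [ai|ia] := ltnP (i + csize D + csize E - 1) b.
    by rewrite comp_crossRE //; lia.
  rewrite (comp_innerE _ _ (a.+1 - i) (b.+1 - i)); try lia.
  by rewrite comp_crossRE //; lia.
Qed.

(** The two gluings use distinct edges of [C], so no arc undergoes [special] twice; gluing [D] first
    merely shifts the later edge [j] by [csize D - 1]. *)
Lemma comp_parA C i D j E k : is_bnc C -> is_bnc D -> is_bnc E ->
  1 <= i -> i < j <= csize C -> k.+1 = j + csize D ->
  comp (comp C i D) k E = comp (comp C j E) i D.
Proof.
move=> bC bD bE hi hj hk; have hm := bnc_size_gt0 bD; have he := bnc_size_gt0 bE.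
have sCD := csize_comp C i D; have sCE := csize_comp C j E.
apply: config_ext => [|a b]; first by rewrite !csize_comp; lia.
case: compP; [lia|lia|..].
- by move=> ?; rewrite comp_notarcE //; lia.
- move=> Ea Eb; rewrite (comp_afterE _ _ j j.+1); try lia.
  rewrite (comp_afterE _ _ j (j + csize E)); try lia.
  by rewrite comp_glueE //; lia.
- move=> a' b' *; rewrite (comp_afterE _ _ (a' + j - 1) (b' + j - 1)); try lia.
  by rewrite (comp_innerE _ _ a' b') //; lia.
- move=> ? ? ?; case: (compP (D := D)); try lia.
  + by move=> *; rewrite comp_glueE; try lia; rewrite comp_beforeE //; lia.
  + by move=> a' b' *; rewrite (comp_innerE _ _ a' b') //; lia.
  + by move=> *; rewrite !comp_beforeE //; lia.
  + move=> a' b' *; rewrite (comp_afterE _ _ a' b'); try lia.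
    by rewrite comp_beforeE //; lia.
  + move=> b' *; rewrite (comp_overE _ _ b'); try lia.
    by rewrite comp_beforeE //; lia.
  + by move=> *; rewrite comp_crossLE //; lia.
  + by move=> *; rewrite comp_crossRE //; lia.
- move=> a' b' ? ? ? ? ?; case: (@compP C D i _ _ a' b'); try lia.
  + move=> a'' b'' *.
    rewrite (comp_afterE _ _ (a'' + csize E - 1) (b'' + csize E - 1)); try lia.
    by rewrite (comp_afterE _ _ a'' b'') //; lia.
- move=> b' ? ? ? ? ? ?; case: (@compP C D i _ _ a b'); try lia.
  + move=> a'' b'' *; rewrite (comp_afterE _ _ a'' (b'' + csize E - 1)); try lia.
    by rewrite (comp_overE _ _ b'') //; lia.
  + move=> b'' *; rewrite (comp_overE _ _ (b'' + csize E - 1)); try lia.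
    by rewrite (comp_overE _ _ b'') //; lia.
  + by move=> *; rewrite comp_crossRE //; lia.
- move=> *; have [aim|ima] := ltnP a (i + csize D).
    have [ai|ia] := leqP a i; last by rewrite comp_crossRE //; lia.
    rewrite (comp_overE _ _ (b.+1 - csize D)); try lia.
    by rewrite comp_crossLE //; lia.
  rewrite (comp_afterE _ _ (a.+1 - csize D) (b.+1 - csize D)); try lia.
  by rewrite comp_crossLE //; lia.
- move=> *; rewrite (comp_afterE _ _ (a.+1 - csize D) (b.+1 - csize D)); try lia.
  by rewrite comp_crossRE //; lia.
Qed.

(** * Evaluation of trees *)

Lemma bnc_unit : is_bnc unit_bnc.
Proof.
split=> //= [a b|a b|a b c d]; rewrite /cross; do ?case: ifP => //; lia.
Qed.

Lemma bnc_gen g : is_bnc (gen_val g).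
Proof.
by case: g; split=> //= [a b|a b|a b c d]; rewrite /cross; do ?case: ifP => //; lia.
Qed.

Lemma csize_gen g : csize (gen_val g) = 2. Proof. by case: g. Qed.

Lemma arity_gt0 t : 1 <= arity t.
Proof. by elim: t => //= g l Hl r Hr; lia. Qed.

Lemma csize_ev t : csize (ev t) = arity t.
Proof. by elim: t => //= g l -> r ->; rewrite csize_gen; lia. Qed.

Lemma bnc_ev t : is_bnc (ev t).
Proof.
elim: t => [|g l Hl r Hr]; first exact: bnc_unit.
apply: bnc_comp => //; last by rewrite csize_comp csize_gen csize_ev; lia.
by apply: bnc_comp; rewrite ?csize_gen //; apply: bnc_gen.
Qed.

(** Grafting into the left subtree is one use of sequential associativity. For the right subtree,
    parallel associativity first moves [ev u] inside the gluing of [ev l], then sequential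
    associativity applies. *)
Lemma ev_graft t i u : 1 <= i <= arity t ->
  ev (graft t i u) = comp (ev t) i (ev u).
Proof.
elim: t i => [|g l IHl r IHr] i /= hi.
  by rewrite (_ : i = 1); [rewrite eqxx comp_unit_l //; apply: bnc_ev|lia].
have hl := arity_gt0 l; have hr := arity_gt0 r.
have bl := bnc_ev l; have br := bnc_ev r; have bu := bnc_ev u.
have bg := bnc_gen g; have sg := csize_gen g.
have bgr : is_bnc (comp (gen_val g) 2 (ev r)) by apply: bnc_comp; rewrite ?sg.
case: leqP => il /=.
  rewrite IHl; last by lia.
  by rewrite (@comp_seqA (comp _ 2 _) 1 _ i) // ?csize_comp ?csize_ev ?sg; lia.
rewrite IHr; last by lia.
have -> : comp (comp (comp (gen_val g) 2 (ev r)) 1 (ev l)) i (ev u) =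
          comp (comp (comp (gen_val g) 2 (ev r)) (i - arity l).+1 (ev u)) 1 (ev l).
  by apply: comp_parA; rewrite ?csize_comp ?csize_ev ?sg //; lia.
congr comp; symmetry; apply: comp_seqA; rewrite ?csize_ev ?sg //; lia.
Qed.

Lemma ev_gtree g : ev (gtree g) = gen_val g.
Proof.
have bg := bnc_gen g.
by rewrite /= !comp_unit_r ?csize_gen //; apply: bnc_gen.
Qed.

Lemma in_O_ev t : in_O (ev t).
Proof.
move=> P PB P1 PC PS PW; elim: t => [|g l Hl r Hr] //=.
have Pg : P (gen_val g) by case: g.
apply: (PC) => //; last by rewrite csize_comp csize_gen csize_ev; have := arity_gt0 r; lia.
by apply: PC => //; rewrite csize_gen.
Qed.

Lemma ev_in_O x : in_O x -> exists t, ev t = x.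
Proof.
(* Minimality of the suboperad is applied to the set of values of trees, which is itself a suboperad
   containing both generators. *)
move=> /(_ (fun y => exists t, ev t = y)); apply.
- by move=> _ [t <-]; apply: bnc_ev.
- by exists Leaf.
- by move=> _ _ i [t <-] [u <-] hi; exists (graft t i u); rewrite ev_graft -?csize_ev.
- by exists (gtree GS); rewrite ev_gtree.
- by exists (gtree GW); rewrite ev_gtree.
Qed.

(** * Arc colours in the value of a node *)

Section EvNode.
Variables (g : gen) (l r : tree).
Let hl := arity_gt0 l.
Let hr := arity_gt0 r.
Let sg := csize_gen g.
Let sl := csize_ev l.
Let sr := csize_ev r.
Let sgr := csize_comp (gen_val g) 2 (ev r).

Lemma ev_node_base :
  ccol (ev (Node g l r)) 1 (arity (Node g l r)).+1 = ccol (gen_val g) 1 3.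
Proof.
(* Vertex 3 of the triangle becomes [(arity r).+2] once [ev r] is glued, before [ev l] shifts it
   again. *)
rewrite [ev _]/= [arity _]/= (comp_overE _ _ (arity r).+2); try lia.
by rewrite (comp_overE _ _ 3) //; lia.
Qed.

Lemma ev_node_left a b : [&& 1 <= a, a < b & b <= (arity l).+1] ->
  b < a + arity l -> ccol (ev (Node g l r)) a b = ccol (ev l) a b.
Proof. by move=> *; rewrite [ev _]/= (comp_innerE _ _ a b) //; lia. Qed.

Lemma ev_node_split : ccol (ev (Node g l r)) 1 (arity l).+1 =
  special (ccol (gen_val g) 1 2) (ccol (ev l) 1 (arity l).+1).
Proof.
rewrite [ev (Node _ _ _)]/= comp_glueE ?sl; try lia.
by rewrite comp_beforeE //; lia.
Qed.

(** The base of [ev r] is included: the second edge of both generators is blue, so this gluing keeps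
    its colour. *)
Lemma ev_node_right a b : [&& 1 <= a, a < b & b <= (arity r).+1] ->
  ccol (ev (Node g l r)) (a + arity l) (b + arity l) = ccol (ev r) a b.
Proof.
move=> hab; rewrite [ev _]/= (comp_afterE _ _ a.+1 b.+1); try lia.
have [Eb|nb] := eqVneq b (a + arity r); last first.
  by rewrite (comp_innerE _ _ a b) //; lia.
rewrite comp_glueE; try lia.
have -> : a = 1 by lia.
have -> : b = (csize (ev r)).+1 by lia.
have -> : ccol (gen_val g) 2 3 = Blue by case: g.
by rewrite special_blue_l //; apply/bnc_base_neq_red/bnc_ev.
Qed.

(** Such an arc would cross the one along which [ev r] is glued. *)
Lemma ev_node_uncol v : (arity l).+1 < v <= arity l + arity r ->
  ccol (ev (Node g l r)) 1 v = Uncol.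
Proof.
move=> hv; rewrite [ev _]/= (comp_overE _ _ (v.+1 - arity l)); try lia.
by rewrite comp_crossLE //; lia.
Qed.

End EvNode.

(** * Normal forms *)

Definition same_root (g : gen) (t : tree) : bool :=
  match g, t with
  | GW, Node GW _ _ | GS, Node GS _ _ => true
  | _, _ => false
  end.

Fixpoint normal (t : tree) : bool :=
  if t is Node g l r then [&& ~~ same_root g l, normal l & normal r] else true.

Definition root_color (t : tree) : color :=
  if t is Node GW _ _ then Uncol else Blue.

Lemma ev_base t : ccol (ev t) 1 (arity t).+1 = root_color t.
Proof. by case: t => // g l r; rewrite ev_node_base; case: g. Qed.

(** Under [GW] the left child is rooted at [GS], and blue meets blue; under [GS] it is rooted at
    [GW], and two uncoloured arcs give red. *)
Lemma ev_node_split_colored g l r : 1 < arity l -> ~~ same_root g l ->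
  ccol (ev (Node g l r)) 1 (arity l).+1 <> Uncol.
Proof.
by rewrite ev_node_split ev_base; case: g; case: l => // -[].
Qed.

(** Gluing may erase the base colour of the left subtree, as [special] is not injective; normality
    recovers it from the parent and the arity. *)
Lemma root_color_left g l : ~~ same_root g l ->
  root_color l = if g is GS then if arity l == 1 then Blue else Uncol else Blue.
Proof.
case: g; case: l => [|[] a b] //= _; rewrite ifF //.
by have := arity_gt0 a; have := arity_gt0 b; lia.
Qed.

Lemma ev_inj t1 t2 : normal t1 -> normal t2 -> ev t1 = ev t2 -> t1 = t2.
Proof.
elim: t1 t2 => [|g l IHl r IHr] [|g' l' r'] // N1 N2 E.
- by have := congr1 csize E; rewrite !csize_ev /=; move: (arity_gt0 l') (arity_gt0 r'); lia.
- by have := congr1 csize E; rewrite !csize_ev /=; move: (arity_gt0 l) (arity_gt0 r); lia.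
have sE : arity (Node g l r) = arity (Node g' l' r') by rewrite -!csize_ev E.
have := ev_base (Node g' l' r'); rewrite -E -sE ev_base => Eg; rewrite /= in sE.
have {Eg} Eg : g = g' by case: g {N1 E IHl IHr sE} Eg; case: g' {N2}.
subst g'; case/and3P: N1 => n1 Nl Nr; case/and3P: N2 => n2 Nl' Nr'.
have hl := arity_gt0 l; have hl' := arity_gt0 l'.
have hr := arity_gt0 r; have hr' := arity_gt0 r'.
have El : arity l = arity l'.
  (* If the arities differ, the splitting arc of the tree with the larger left subtree is coloured
     there, but in the other tree it ends strictly inside the right polygon, hence is uncoloured. *)
  case: (ltngtP (arity l) (arity l')) => // h.
    have := @ev_node_split_colored g l' r' _ n2; rewrite -E ev_node_uncol; last by lia.
    by case=> //; lia.
  have := @ev_node_split_colored g l r _ n1; rewrite E ev_node_uncol; last by lia.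
  by case=> //; lia.
have Er : arity r = arity r' by lia.
congr Node; [apply: IHl|apply: IHr] => //.
  apply: config_ext => [|a b]; first by rewrite !csize_ev.
  have [arc|na] := boolP [&& 1 <= a, a < b & b <= (arity l).+1]; last first.
    by rewrite !bnc_notarc ?csize_ev -?El //; apply: bnc_ev.
  have [lt|ge] := ltnP b (a + arity l).
    by rewrite -(@ev_node_left g l r) // E ev_node_left // -El.
  (* Only the base of the left subtree remains, the one arc altered by gluing. *)
  have -> : a = 1 by lia.
  have -> : b = (arity l).+1 by lia.
  by rewrite {2}El !ev_base (root_color_left n1) (root_color_left n2) El.
apply: config_ext => [|a b]; first by rewrite !csize_ev.
have [arc|na] := boolP [&& 1 <= a, a < b & b <= (arity r).+1]; last first.
  by rewrite !bnc_notarc ?csize_ev -?Er //; apply: bnc_ev.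
by rewrite -(@ev_node_right g l r) // E El ev_node_right // -Er.
Qed.

(** * Rewriting trees to normal form *)

Lemma cong_node g l l' r r' : cong l l' -> cong r r' ->
  cong (Node g l r) (Node g l' r').
Proof.
move=> cl cr; apply: (cong_trans (t' := Node g l r')).
  (* A node is its corolla with [r] grafted at leaf 2, then [l] at leaf 1; in this order no index
     shifts. *)
  exact: (cong_compl l (i := 1) (cong_compr (t := gtree g) (i := 2) cr isT) isT).
exact: (cong_compr (t := Node g Leaf r') (i := 1) cl isT).
Qed.

Lemma cong_w a b c : cong (Node GW (Node GW a b) c) (Node GW a (Node GW b c)).
Proof.
(* The leaves are filled from right to left, so the remaining positions keep their numbers. *)
have h := cong_compl c (i := 3) cong_relw isT.
have h2 := cong_compl b (i := 2) h isT.
exact: (cong_compl a (i := 1) h2 isT).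
Qed.

Lemma cong_s a b c : cong (Node GS (Node GS a b) c) (Node GS a (Node GW b c)).
Proof.
have h := cong_compl c (i := 3) cong_rels isT.
have h2 := cong_compl b (i := 2) h isT.
exact: (cong_compl a (i := 1) h2 isT).
Qed.

(** List append on right combs of [GW]: the first rule is iterated down the right spine of [l], by
    structural recursion, so no termination argument for rewriting is required. *)
Fixpoint wcat (l r : tree) : tree :=
  if l is Node GW a b then Node GW a (wcat b r) else Node GW l r.

(** One use of the second rule is enough: when [l] is normal, [a] is not rooted at [GS]. *)
Definition scat (l r : tree) : tree :=
  if l is Node GS a b then Node GS a (wcat b r) else Node GS l r.

Fixpoint norm (t : tree) : tree :=
  match t with
  | Leaf => Leaf
  | Node GW l r => wcat (norm l) (norm r)
  | Node GS l r => scat (norm l) (norm r)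
  end.

Lemma cong_wcat l r : cong (Node GW l r) (wcat l r).
Proof.
elim: l => [|[] a _ b IHb]; try exact: cong_refl.
exact: (cong_trans (cong_w a b r) (cong_node _ (cong_refl a) IHb)).
Qed.

Lemma cong_scat l r : cong (Node GS l r) (scat l r).
Proof.
case: l => [|[] a b]; try exact: cong_refl.
exact: (cong_trans (cong_s a b r) (cong_node _ (cong_refl a) (cong_wcat b r))).
Qed.

Lemma cong_norm t : cong t (norm t).
Proof.
elim: t => [|[] l Hl r Hr] /=; first exact: cong_refl.
  exact: (cong_trans (cong_node _ Hl Hr) (cong_scat _ _)).
exact: (cong_trans (cong_node _ Hl Hr) (cong_wcat _ _)).
Qed.

Lemma normal_wcat l r : normal l -> normal r -> normal (wcat l r).
Proof.
move=> + Nr; elim: l => [|[] a _ b IHb] //=; first by move=> ->.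
by case/and3P=> -> -> /IHb.
Qed.

Lemma normal_norm t : normal (norm t).
Proof.
elim: t => [|[] l Hl r Hr] //=; last exact: normal_wcat.
case: (norm l) Hl => [|[] a b] //= => [/and3P[-> -> Nb]|->] //=.
exact: normal_wcat.
Qed.

(** * The relations hold in CNCB *)

Lemma ev_graft_gtree g i h : 1 <= i <= 2 ->
  ev (graft (gtree g) i (gtree h)) = comp (gen_val g) i (gen_val h).
Proof. by move=> hi; rewrite ev_graft // !ev_gtree. Qed.

Lemma comp_ww : comp w_gen 1 w_gen = comp w_gen 2 w_gen.
Proof.
apply: config_ext => // a b /=; case: ifP => // arc.
(* The composite is a quadrilateral, so finitely many arcs are checked by computation. *)
have [] : a <= 3 /\ b <= 4 by lia.
by case: a {arc} => [|[|[|[|a]]]] //; case: b => [|[|[|[|[|b]]]]].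
Qed.

Lemma comp_ss : comp s_gen 1 s_gen = comp s_gen 2 w_gen.
Proof.
apply: config_ext => // a b /=; case: ifP => // arc.
have [] : a <= 3 /\ b <= 4 by lia.
by case: a {arc} => [|[|[|[|a]]]] //; case: b => [|[|[|[|[|b]]]]].
Qed.

Lemma cong_ev t1 t2 : cong t1 t2 -> ev t1 = ev t2.
Proof.
elim=> {t1 t2}.
- by rewrite !ev_graft_gtree // comp_ww.
- by rewrite !ev_graft_gtree // comp_ss.
- by [].
- by [].
- by move=> ? t' ? _ -> _ ->.
- move=> t t' u i _ E hi; rewrite !ev_graft ?E //.
  (* The index is valid for [t'] too: equal values have equal sizes, hence the trees have equal
     arities. *)
  by rewrite -csize_ev -E csize_ev.
- by move=> t u u' i _ E hi; rewrite !ev_graft ?E.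
Qed.

Theorem theorem3p30 :
  (forall x : config, in_O x <-> exists t : tree, ev t = x) /\
  (forall t1 t2 : tree, ev t1 = ev t2 <-> cong t1 t2).
Proof.
split=> [x|t1 t2]; split; first exact: ev_in_O.
- by case=> t <-; apply: in_O_ev.
- move=> E; have [c1 c2] := (cong_norm t1, cong_norm t2).
  have En : norm t1 = norm t2.
    by apply: ev_inj; rewrite ?normal_norm // -(cong_ev c1) -(cong_ev c2).
  by apply: cong_trans c1 _; rewrite En; apply: cong_sym.
- exact: cong_ev.
Qed.
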